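(* Let $\mathfrak{E},\mathfrak{H},\mathfrak{K}$ be Hilbert spaces and let $A\in\mathbf{B}(\mathfrak{E},\mathfrak{H})$ and $B\in\mathbf{B}(\mathfrak{E},\mathfrak{K})$. Then the following statements are equivalent: (i) $B$ is almost dominated by $A$; (ii) $B=CA$ holds for some closable linear operator $C$ from $\mathfrak{H}$ to $\mathfrak{K}$; (iii) $B=CA$ holds for some closed linear operator $C$ from $\mathfrak{H}$ to $\mathfrak{K}$. If one of these conditions is satisfied, then $L(A,B)$ is a closable linear operator such that $B=L(A,B)A$. Moreover, if $B=CA$ holds for some closable linear operator $C$ from $\mathfrak{H}$ to $\mathfrak{K}$, then $L(A,B)\subset C$; and if $B=CA$ holds for some closed linear operator $C$ from $\mathfrak{H}$ to $\mathfrak{K}$, then $L(A,B)^{**}\subset C$.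
   Context: $\mathbf{B}(\mathfrak{X},\mathfrak{Y})$ denotes the everywhere defined bounded linear operators from the Hilbert space $\mathfrak{X}$ to the Hilbert space $\mathfrak{Y}$. A linear operator $C$ from $\mathfrak{H}$ to $\mathfrak{K}$ is defined on a linear subspace $\operatorname{dom}C\subset\mathfrak{H}$, which need not be dense; it is identified with its graph in $\mathfrak{H}\times\mathfrak{K}$, and inclusions are inclusions of graphs. It is closable if the closure of its graph is the graph of an operator. The equality $B=CA$ includes $\operatorname{ran}A\subset\operatorname{dom}C$. A linear relation $T$ from $\mathfrak{H}$ to $\mathfrak{K}$ is a linear subspace of $\mathfrak{H}\times\mathfrak{K}$; $T^{**}$ is its closure. $L(A,B)=\{\{Af,Bf\}: f\in\mathfrak{E}\}$, a linear relation from $\mathfrak{H}$ to $\mathfrak{K}$. $B$ is almost dominated by $A$ if there exist Hilbert spaces $\mathfrak{K}_n$, operators $B_n\in\mathbf{B}(\mathfrak{E},\mathfrak{K}_n)$ and numbers $c_n\ge0$ such that for all $f\in\mathfrak{E}$: (a) $\|B_nf\|\le c_n\|Af\|$; (b) $\|B_nf\|\le\|B_{n+1}f\|$; (c) $\|B_nf\|\nearrow\|Bf\|$. *)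

(* Defs.v *)
From HB Require Import structures.
From mathcomp Require Import all_boot all_order all_algebra complex.
From mathcomp Require Import all_classical all_reals all_analysis.

Set Implicit Arguments.
Unset Strict Implicit.
Unset Printing Implicit Defensive.

Import Order.TTheory GRing.Theory Num.Theory numFieldNormedType.Exports.

Local Open Scope classical_set_scope.
Local Open Scope ring_scope.
Local Open Scope complex_scope.

(* Hilbert spaces are complex: modules over R[i], with R a model of the real
   numbers, that are complete for the norm of an inner product (linear in the
   first argument, conjugate-linear in the second). *)
HB.mixin Record CompleteNormedModule_isHilbert (R : realType) V
    of CompleteNormedModule R[i] V := {
  inner : {dot V for @Num.conj R[i]} ;
  inner_normE : forall x : V, inner x x = `|x| ^+ 2 }.

#[short(type="hilbertType")]
HB.structure Definition Hilbert (R : realType) :=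
  { V of CompleteNormedModule R[i] V & CompleteNormedModule_isHilbert R V }.

(* The norm of a module over R[i] takes its values in R[i]; they are
   nonnegative, so that nothing is lost in the real part. *)
Definition hnorm (R : realType) (X : hilbertType R) (x : X) : R :=
  complex.Re `|x|.

Definition bounded_operator (R : realType) (X Y : hilbertType R)
    (T : {linear X -> Y}) : Prop :=
  exists M : R, forall x, hnorm (T x) <= M * hnorm x.

Definition graph (X Y : Type) (T : X -> Y) : set (X * Y) :=
  [set p | p.2 = T p.1].

Section LinearRelations.
Variables (R : realType) (E H K : hilbertType R).

Definition linear_relation (T : set (H * K)) : Prop :=
  T (0, 0) /\ forall (a : R[i]) u v, T u -> T v -> T (a *: u + v).

Definition rel_dom (T : set (H * K)) : set H := [set h | exists k, T (h, k)].

(* A linear operator, defined on the subspace [rel_dom C] of H, is represented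
   by its graph C. *)
Definition linear_operator (C : set (H * K)) : Prop :=
  linear_relation C /\ forall h k k', C (h, k) -> C (h, k') -> k = k'.

(* The product H * K carries the maximum norm, which is equivalent to its
   Hilbert norm: both have the same closed sets. *)
Definition closed_operator (C : set (H * K)) : Prop :=
  linear_operator C /\ closed C.

Definition closable_operator (C : set (H * K)) : Prop :=
  linear_operator C /\ linear_operator (closure C).

Definition rel_comp (C : set (H * K)) (A : set (E * H)) : set (E * K) :=
  [set p | exists h, A (p.1, h) /\ C (h, p.2)].

(* B = C A, including ran A `<=` dom C. *)
Definition factors (B : E -> K) (C : set (H * K)) (A : E -> H) : Prop :=
  range A `<=` rel_dom C /\ graph B = rel_comp C (graph A).

Definition rel_L (A : E -> H) (B : E -> K) : set (H * K) :=
  range (fun f => (A f, B f)).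

Definition almost_dominated (B : E -> K) (A : E -> H) : Prop :=
  exists (Kn : nat -> hilbertType R) (Bn : forall n, {linear E -> Kn n})
    (c : nat -> R),
    [/\ forall n, bounded_operator (Bn n),
        forall n, 0 <= c n
      & forall f,
        [/\ forall n, hnorm (Bn n f) <= c n * hnorm (A f),
            forall n, hnorm (Bn n f) <= hnorm (Bn n.+1 f)
          & hnorm (Bn n f) @[n --> \oo] --> hnorm (B f)]].

End LinearRelations.

(* Main.v *)
Require Import Defs.
From HB Require Import structures.
From mathcomp Require Import all_boot all_order all_algebra complex.
From mathcomp Require Import all_classical all_reals all_analysis.
From mathcomp Require Import ring lra.

Set Implicit Arguments.
Unset Strict Implicit.
Unset Printing Implicit Defensive.

Import Order.TTheory GRing.Theory Num.Theory numFieldNormedType.Exports.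

Local Open Scope classical_set_scope.
Local Open Scope ring_scope.

(** Every condition reduces to one about [rel_L A B]. If [B = C A], then
    [C (A f, B f)] for all [f], that is, [rel_L A B] is contained in [C]; this
    gives the two minimality claims, while (iii) follows from (ii) by passing to
    the closure of [C]. The content of the theorem is the passage between almost
    domination and closability.

    From (i) to closability ([almost_dominated_closure0]): let [(A g, B g)] come
    close to [(0, k)]. Each [B_n g] is small because [A g] is, while
    [|B_n (f - g)| <= |B (f - g)|] with [B f] and [B g] both close to [k]. Hence
    [|B_n f|] is small uniformly in [n], so [|B f|], the limit, is small, and so
    is [|k|].

    From (iii) to (i) ([closed_factor_almost_dominated]): [C] is regularized in
    the manner of Moreau and Yosida. For [s > 0] give H * K the real quadratic
    form [|k|^2 + s |h|^2], written [wsq s]. The closed subspace [C] contains a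
    point [(g, C g)] nearest to [(h, 0)], the minimizer of
    [|C g|^2 + s |h - g|^2]; it is an orthogonal projection, so [h |-> C g]
    is linear. (For a densely defined [C] it is [C (1 + C^* C / s)^-1].) Let
    [B_n f := C g] for [h = A f] and [s = n + 1], so that all [B_n] take their
    values in K. Then
    - comparing with [g = 0] gives [|B_n f| <= sqrt (n + 1) |A f|]
      ([regularization_bounded]);
    - comparing the minimizers for two weights with each other shows that
      [|B_n f|] increases ([regularization_monotone]);
    - the minimal values increase and are bounded by [|C h|^2], so by
      Pythagoras the minimizers are Cauchy; their first components tend to [h],
      so the limit is [(h, C h)] since [C] is closed and single-valued
      ([regularization_cvg]). *)

(** * Real sequences and quadratics *)

(** The discriminant inequality, which remains valid when the leading
    coefficient [a] vanishes. It is applied to the values of a quadratic form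
    along a line, both for the Cauchy-Schwarz inequality and for the approximate
    orthogonality of a near-minimizer. *)
Lemma sqr_le_disc (R : realFieldType) (e w a : R) :
  0 <= a -> (forall t, 0 <= e - 2 * t * w + t ^+ 2 * a) -> w ^+ 2 <= e * a.
Proof.
move=> a0 q; have [a1|a1] := eqVneq a 0.
  have [->|w0] := eqVneq w 0; first by rewrite a1 expr0n /= mulr0.
  have := q ((e + 1) / (2 * w)); rewrite a1.
  have -> : e - 2 * ((e + 1) / (2 * w)) * w + ((e + 1) / (2 * w)) ^+ 2 * 0 = -1.
    by field.
  by rewrite oppr_ge0 ler10.
have {}a0 : 0 < a by rewrite lt_def a1.
have := q (w / a).
have -> : e - 2 * (w / a) * w + (w / a) ^+ 2 * a = e - w ^+ 2 / a by field.
by rewrite subr_ge0 ler_pdivrMr.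
Qed.

Lemma natSinv_lt (R : realType) (e : R) :
  0 < e -> exists N, forall n, (N <= n)%N -> n.+1%:R^-1 < e.
Proof.
move=> e0; have [N _ Ne] := near_infty_natSinv_lt (PosNum e0).
by exists N => n; exact: Ne.
Qed.

Lemma bounded_nondecreasing_cauchy (R : realType) (t : nat -> R) M :
  (forall m n, (n <= m)%N -> t n <= t m) -> (forall n, t n <= M) ->
  forall e : R, 0 < e -> exists N, forall m n, (N <= n)%N -> (n <= m)%N ->
    t m - t n < e.
Proof.
move=> tmono tM e e0.
have tsup : has_sup (range t).
  by split; [exists (t 0%N), 0%N|exists M => _ [n _ <-]].
have [_ [N _ <-] tN] := sup_adherent e0 tsup.
exists N => m n Nn nm; have := tmono _ _ Nn.
have : t m <= sup (range t) by apply: ub_le_sup; [exact: tsup.2|exists m].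
lra.
Qed.

(** * Real norm and real inner product *)

Section RealInnerProduct.
Variables (R : realType) (X : hilbertType R).
Implicit Types (x y z : X) (t : R).

(** The complex inner product is only used through its real part. Orthogonality
    to a complex subspace is the same for both, by [rdotZC] with [a] imaginary. *)
Definition rdot x y : R := complex.Re (inner x y).

Lemma norm_hnormE x : `|x| = (hnorm x)%:C%C.
Proof. by rewrite /hnorm RRe_real// ger0_real. Qed.

Lemma hnorm_ge0 x : 0 <= hnorm x.
Proof. rewrite -lecR -norm_hnormE; exact: normr_ge0. Qed.

Lemma hnorm0 : hnorm (0 : X) = 0.
Proof. by rewrite /hnorm normr0. Qed.

Lemma hnorm_eq0 x : hnorm x = 0 -> x = 0.
Proof. by move=> x0; apply/eqP; rewrite -normr_eq0 norm_hnormE x0. Qed.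

Lemma hnormN x : hnorm (- x) = hnorm x.
Proof. by rewrite /hnorm normrN. Qed.

Lemma ler_hnormD x y : hnorm (x + y) <= hnorm x + hnorm y.
Proof. by rewrite -lecR rmorphD/= -!norm_hnormE ler_normD. Qed.

Lemma hnormBC x y : hnorm (x - y) = hnorm (y - x).
Proof. by rewrite /hnorm distrC. Qed.

Lemma hnormZ (a : R[i]) x : hnorm (a *: x) = complex.Re `|a| * hnorm x.
Proof. by rewrite /hnorm normrZ norm_hnormE; case: `|a| => ? ? /=; ring. Qed.

Lemma rdotE x : rdot x x = hnorm x ^+ 2.
Proof. by rewrite /rdot inner_normE norm_hnormE -rmorphXn. Qed.

Lemma rdotC x y : rdot x y = rdot y x.
Proof.
rewrite /rdot hermC expr0 mul1r.
have Re_conj (z : R[i]) : complex.Re (Num.conj z) = complex.Re z by case: z.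
exact: Re_conj.
Qed.

Lemma rdotDl x y z : rdot (x + y) z = rdot x z + rdot y z.
Proof. by rewrite /rdot linearDl raddfD. Qed.

(** This is what makes projections for the real form complex linear. *)
Lemma rdotZC (a : R[i]) x y : rdot (a *: x) y = rdot x (Num.conj a *: y).
Proof. by rewrite /rdot linearZl_LR linearZr_LR /= conjCK. Qed.

Lemma rdotZl t x y : rdot (t%:C%C *: x) y = t * rdot x y.
Proof.
rewrite /rdot linearZl_LR.
have ReZ (z : R[i]) : complex.Re (t%:C%C * z) = t * complex.Re z.
  by case: z => a b /=; rewrite mul0r subr0.
exact: ReZ.
Qed.

End RealInnerProduct.

Lemma ler_hnorm_dist (R : realType) (X : hilbertType R) (x y : X) :
  `|hnorm x - hnorm y| <= hnorm (x - y).
Proof.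
rewrite ler_norml; have := ler_hnormD (x - y) y; have := ler_hnormD (y - x) x.
by rewrite !subrK hnormBC => ? ?; apply/andP; split; lra.
Qed.

(** * Limits and closures through the real norm *)

Section Topology.
Variable R : realType.

Lemma Re_gt0 (e : R[i]) : 0 < e -> 0 < complex.Re e.
Proof. by rewrite ltcE => /andP[]. Qed.

Lemma ball_hnorm (X : hilbertType R) (x y : X) (e : R[i]) :
  0 < e -> ball x e y <-> hnorm (x - y) < complex.Re e.
Proof.
move=> e0; rewrite -ball_normE /ball_/= norm_hnormE.
have <- : (complex.Re e)%:C%C = e by rewrite RRe_real// gtr0_real.
by rewrite ltcR.
Qed.

(** Completeness of [X], read off from the real-valued norm. *)
Lemma hnorm_complete (X : hilbertType R) (u : nat -> X) :
  (forall e : R, 0 < e -> exists N, forall m n, (N <= n)%N -> (n <= m)%N ->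
    hnorm (u m - u n) < e) ->
  exists x, forall e : R, 0 < e -> exists N, forall n, (N <= n)%N ->
    hnorm (u n - x) < e.
Proof.
move=> uC.
have /cauchy_cvg/cvg_ex[x ux] : cauchy (u n @[n --> \oo]).
  apply: cauchy_exP => e e0; have [N uN] := uC _ (Re_gt0 e0).
  exists (u N), N => // n /= Nn; apply/ball_hnorm => //.
  by rewrite hnormBC uN.
exists x => e e0.
have e0' : 0 < e%:C%C :> R[i] by rewrite ltcR.
have /cvg_ballP/(_ _ e0') [N _ uN] := ux.
by exists N => n Nn; rewrite hnormBC; apply/(ball_hnorm _ _ e0')/uN.
Qed.

(** This replaces neighbourhoods in the product, and with them the balls of
    complex radius, by real inequalities on the two components. *)
Lemma closure_hnorm (H K : hilbertType R) (T : set (H * K)) h k :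
  closure T (h, k) <-> forall e : R, 0 < e ->
    exists u v, [/\ T (u, v), hnorm (h - u) < e & hnorm (k - v) < e].
Proof.
split=> [Thk e e0|Thk S].
  have e0' : 0 < e%:C%C :> R[i] by rewrite ltcR.
  have [|[u v] [Tuv []]] := Thk (ball (h, k) e%:C%C); first exact: nbhsx_ballx.
  by move=> /= /(ball_hnorm _ _ e0') hu /(ball_hnorm _ _ e0') kv; exists u, v.
move=> /nbhs_ballP[e /= e0 eS].
have [|u [v [Tuv hu kv]]] := Thk (complex.Re e).
  exact: Re_gt0.
by exists (u, v); split=> //; apply: eS; split; apply/ball_hnorm.
Qed.

End Topology.

(** * A weighted inner product on the product of two spaces *)

Section WeightedForm.
Variables (R : realType) (H K : hilbertType R) (s : R).
Implicit Types (p q r : H * K) (t : R).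

(** The weight [s] stands on the first component: as it grows, the point of a
    subspace nearest to [(h, 0)] is forced to have first component close to
    [h]. *)
Definition wdot p q : R := rdot p.2 q.2 + s * rdot p.1 q.1.
Definition wsq p : R := wdot p p.

Lemma wsqE p : wsq p = hnorm p.2 ^+ 2 + s * hnorm p.1 ^+ 2.
Proof. by rewrite /wsq /wdot !rdotE. Qed.

Lemma wdotC p q : wdot p q = wdot q p.
Proof. by rewrite /wdot rdotC (rdotC p.1). Qed.

Lemma wdotDl p q r : wdot (p + q) r = wdot p r + wdot q r.
Proof. by rewrite /wdot !rdotDl; ring. Qed.

Lemma wdotZC (a : R[i]) p q : wdot (a *: p) q = wdot p (Num.conj a *: q).
Proof. by rewrite /wdot !rdotZC. Qed.

Lemma wdotZl t p q : wdot (t%:C%C *: p) q = t * wdot p q.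
Proof. by rewrite /wdot !rdotZl; ring. Qed.

Lemma wdotNl p q : wdot (- p) q = - wdot p q.
Proof.
have -> : - p = (-1 : R)%:C%C *: p by rewrite rmorphN1 scaleN1r.
by rewrite wdotZl mulN1r.
Qed.

Lemma wdotDr p q r : wdot p (q + r) = wdot p q + wdot p r.
Proof. by rewrite wdotC wdotDl !(wdotC p). Qed.

Lemma wdotNr p q : wdot p (- q) = - wdot p q.
Proof. by rewrite wdotC wdotNl wdotC. Qed.

Lemma wdotZr t p q : wdot p (t%:C%C *: q) = t * wdot p q.
Proof. by rewrite wdotC wdotZl wdotC. Qed.

Definition wdot_lin :=
  (wdotDl, wdotDr, wdotNl, wdotNr, wdotZl, wdotZr).

Lemma wsqN p : wsq (- p) = wsq p.
Proof. by rewrite /wsq !wdot_lin opprK. Qed.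

Lemma wsqBC p q : wsq (p - q) = wsq (q - p).
Proof. by rewrite -wsqN opprB. Qed.

Hypothesis s0 : 0 < s.

Lemma wsq_ge0 p : 0 <= wsq p.
Proof. by rewrite wsqE addr_ge0 ?sqr_ge0// mulr_ge0 ?sqr_ge0// ltW. Qed.

Lemma wsq_eq0 p : wsq p = 0 -> p = 0.
Proof.
move/eqP; rewrite wsqE paddr_eq0 ?mulr_ge0 ?exprn_ge0 ?hnorm_ge0 ?(ltW s0)//.
rewrite sqrf_eq0 mulf_eq0 (gt_eqF s0) /= sqrf_eq0 => /andP[/eqP p2 /eqP p1].
by rewrite [p]surjective_pairing (hnorm_eq0 p1) (hnorm_eq0 p2).
Qed.

Lemma wdot_cauchy_schwarz p q : wdot p q ^+ 2 <= wsq p * wsq q.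
Proof.
apply: sqr_le_disc => [|t]; first exact: wsq_ge0.
have := wsq_ge0 (p - t%:C%C *: q).
rewrite {1}/wsq !wdot_lin -/(wsq p) -/(wsq q) (wdotC q p).
by congr (_ <= _); ring.
Qed.

Lemma hnorm_fst_sq_le p : hnorm p.1 ^+ 2 <= wsq p / s.
Proof. by rewrite ler_pdivlMr// wsqE mulrC lerDr sqr_ge0. Qed.

Lemma hnorm_snd_sq_le p : hnorm p.2 ^+ 2 <= wsq p.
Proof. by rewrite wsqE lerDl mulr_ge0 ?sqr_ge0// ltW. Qed.

Lemma hnorm_lt_of_wsq p (e : R) :
  0 < e -> wsq p < Num.min (e ^+ 2) (s * e ^+ 2) ->
  hnorm p.1 < e /\ hnorm p.2 < e.
Proof.
move=> e0; rewrite lt_min => /andP[pe pse]; split.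
  rewrite -(ltr_pXn2r (n := 2))// ?nnegrE ?hnorm_ge0 ?(ltW e0)//.
  by apply: le_lt_trans (hnorm_fst_sq_le p) _; rewrite ltr_pdivrMr// mulrC.
rewrite -(ltr_pXn2r (n := 2))// ?nnegrE ?hnorm_ge0 ?(ltW e0)//.
exact: le_lt_trans (hnorm_snd_sq_le p) _.
Qed.

Lemma wsq_lt_of_hnorm (e : R) : 0 < e ->
  exists2 d : R, 0 < d & forall q, hnorm q.1 < d -> hnorm q.2 < d -> wsq q < e.
Proof.
move=> e0; have s1 : 0 < 1 + s by rewrite addr_gt0.
exists (Num.sqrt (e / (1 + s))); first by rewrite sqrtr_gt0 divr_gt0.
move=> q q1 q2.
have h (x : R) : 0 <= x -> x < Num.sqrt (e / (1 + s)) -> x ^+ 2 < e / (1 + s).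
  move=> x0 xe; rewrite -[ltRHS]sqr_sqrtr ?divr_ge0 ?(ltW e0) ?(ltW s1)//.
  by rewrite ltr_pXn2r// ?nnegrE ?sqrtr_ge0.
have {}q1 := h _ (hnorm_ge0 _) q1; have {}q2 := h _ (hnorm_ge0 _) q2.
have -> : e = e / (1 + s) + s * (e / (1 + s)) by field; rewrite gt_eqF.
by rewrite wsqE ltrD// ltr_pM2l.
Qed.

(** For fixed [s > 0] the form [wsq s] defines the topology of H * K, so that it
    inherits completeness. *)
Lemma wsq_complete (x : nat -> H * K) :
  (forall e : R, 0 < e -> exists N, forall m n, (N <= n)%N -> (n <= m)%N ->
    wsq (x m - x n) < e) ->
  exists q, forall e : R, 0 < e -> exists N, forall n, (N <= n)%N ->
    wsq (x n - q) < e.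
Proof.
move=> xC.
have xC' (e : R) : 0 < e -> exists N, forall m n, (N <= n)%N -> (n <= m)%N ->
    hnorm (x m - x n).1 < e /\ hnorm (x m - x n).2 < e.
  move=> e0; have [|N xN] := xC (Num.min (e ^+ 2) (s * e ^+ 2)).
    by rewrite lt_min !(mulr_gt0, exprn_gt0).
  by exists N => m n Nn nm; apply: hnorm_lt_of_wsq => //; exact: xN.
have [|g xg] := @hnorm_complete _ H (fun n => (x n).1).
  by move=> e /xC'[N xN]; exists N => m n Nn nm; have [] := xN m n Nn nm.
have [|k xk] := @hnorm_complete _ K (fun n => (x n).2).
  by move=> e /xC'[N xN]; exists N => m n Nn nm; have [] := xN m n Nn nm.
exists (g, k) => e /wsq_lt_of_hnorm[d d0 de].
have [N1 xN1] := xg _ d0; have [N2 xN2] := xk _ d0.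
exists (maxn N1 N2) => n; rewrite geq_max => /andP[n1 n2].
by apply: de; [exact: xN1|exact: xN2].
Qed.

Lemma closed_wsq (T : set (H * K)) q : closed T ->
  (forall e : R, 0 < e -> exists2 r, T r & wsq (r - q) < e) -> T q.
Proof.
case: q => h k clT Tq; apply/clT/closure_hnorm => e e0.
have [|[u v] Tuv uve] := Tq (Num.min (e ^+ 2) (s * e ^+ 2)).
  by rewrite lt_min !(mulr_gt0, exprn_gt0).
exists u, v; have [] := hnorm_lt_of_wsq e0 uve.
by rewrite /= hnormBC (hnormBC k).
Qed.

End WeightedForm.

Lemma wsq_ler (R : realType) (H K : hilbertType R) (s s' : R) (p : H * K) :
  s <= s' -> wsq s p <= wsq s' p.
Proof. by move=> ss'; rewrite !wsqE lerD2l ler_wpM2r ?sqr_ge0. Qed.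

(** * Orthogonal projection on a closed subspace *)

Section Projection.
Variables (R : realType) (H K : hilbertType R) (T : set (H * K)).
Hypothesis linT : linear_relation T.

Let T0 : T 0. Proof. exact: linT.1. Qed.
Let TD p q : T p -> T q -> T (p + q).
Proof. by move=> Tp Tq; rewrite -[p]scale1r; exact: linT.2. Qed.
Let TZ (a : R[i]) p : T p -> T (a *: p).
Proof. by move=> Tp; rewrite -[_ *: _]addr0; exact: linT.2. Qed.
Let TB p q : T p -> T q -> T (p - q).
Proof. by move=> Tp Tq; apply: TD => //; rewrite -scaleN1r; exact: TZ. Qed.

(** A relation rather than a function, since the projection [q] of [p] on [T]
    may fail to exist when [T] is not closed. *)
Definition orth_proj (s : R) (p q : H * K) : Prop :=
  T q /\ forall r, T r -> wdot s (p - q) r = 0.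

Lemma orth_proj_pythagoras s p q r : orth_proj s p q -> T r ->
  wsq s (p - r) = wsq s (p - q) + wsq s (q - r).
Proof.
move=> [Tq pq] Tr; have -> : p - r = (p - q) + (q - r) by rewrite addrA subrK.
have := pq _ (TB Tq Tr); move: (p - q) (q - r) => x y xy.
by rewrite /wsq !wdot_lin (wdotC _ y x) xy; ring.
Qed.

Lemma orth_proj_inj s p q q' : 0 < s ->
  orth_proj s p q -> orth_proj s p q' -> q = q'.
Proof.
move=> s0 [Tq pq] [Tq' pq']; apply/eqP; rewrite -subr_eq0; apply/eqP.
apply: (wsq_eq0 s0); have Tqq' := TB Tq Tq'.
rewrite /wsq.
have {1}-> : q - q' = (p - q') - (p - q).
  by rewrite opprB [RHS]addrC addrA subrK.
by rewrite wdotDl wdotNl pq' // pq // subrr.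
Qed.

Lemma orth_projL s (a : R[i]) p p' q q' :
  orth_proj s p q -> orth_proj s p' q' ->
  orth_proj s (a *: p + p') (a *: q + q').
Proof.
move=> [Tq pq] [Tq' pq']; split=> [|r Tr]; first exact: linT.2.
have -> : a *: p + p' - (a *: q + q') = a *: (p - q) + (p' - q').
  by rewrite scalerBr opprD addrACA.
by rewrite wdotDl wdotZC pq ?pq' ?addr0//; exact: TZ.
Qed.

(** Moving from [q] in the direction [r] cannot decrease the squared distance to
    [p] by more than [e]; this bounds its derivative, [- 2 * wdot s (p - q) r]. *)
Lemma near_minimizer_orth s p q r d e : 0 < s ->
  (forall x, T x -> d <= wsq s (p - x)) -> T q -> wsq s (p - q) <= d + e ->
  T r -> wdot s (p - q) r ^+ 2 <= e * wsq s r.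
Proof.
move=> s0 dmin Tq qd Tr; apply: sqr_le_disc => [|t]; first exact: wsq_ge0.
have := dmin _ (TD Tq (TZ t%:C%C Tr)); rewrite opprD addrA.
move: (p - q) qd => x xd; rewrite {1}/wsq !wdot_lin -/(wsq s x) -/(wsq s r).
rewrite (wdotC _ r x); lra.
Qed.

(** Two near-minimizers are close: by the parallelogram identity their distance
    is controlled by the excess of their values over that of the midpoint. *)
Lemma near_minimizer_dist s p q q' d e e' :
  (forall x, T x -> d <= wsq s (p - x)) -> T q -> T q' ->
  wsq s (p - q) <= d + e -> wsq s (p - q') <= d + e' ->
  wsq s (q - q') <= 2 * (e + e').
Proof.
move=> dmin Tq Tq' qd qd'.
have := dmin _ (TZ (2^-1 : R)%:C%C (TD Tq Tq')).
have -> : p - (2^-1 : R)%:C%C *: (q + q') =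
    (2^-1 : R)%:C%C *: ((p - q) + (p - q')).
  rewrite addrACA -opprD scalerBr; congr (_ - _).
  rewrite -mulr2n -[p *+ 2]scaler_nat scalerA -(rmorph_nat (real_complex R)).
  by rewrite -rmorphM mulVf ?rmorph1 ?scale1r// pnatr_eq0.
have -> : q - q' = (p - q') - (p - q) by rewrite opprB [RHS]addrC addrA subrK.
move: (p - q) (p - q') qd qd' => x y xd yd.
rewrite /wsq !wdot_lin in xd yd *; rewrite (wdotC _ y x); lra.
Qed.

(** A minimizing sequence [x n] is Cauchy by [near_minimizer_dist]. For its limit
    [q], both terms of [p - q = (p - x n) + (x n - q)] are almost orthogonal to
    [r], the first by near-minimality and the second by Cauchy-Schwarz. *)
Lemma orth_proj_exists s p : 0 < s -> closed T -> exists q, orth_proj s p q.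
Proof.
move=> s0 clT.
pose S := [set wsq s (p - q) | q in T]; pose d := inf S.
have Sinf : has_inf S.
  split; first by exists (wsq s (p - 0)), 0.
  by exists 0 => _ [q _ <-]; exact: wsq_ge0.
have dmin x : T x -> d <= wsq s (p - x).
  by move=> Tx; apply: ge_inf; [exact: Sinf.2|exists x].
have /choice[x xP] : forall n : nat, exists q,
    T q /\ wsq s (p - q) <= d + n.+1%:R^-1.
  move=> n; have n0 : 0 < n.+1%:R^-1 :> R by rewrite invr_gt0.
  by have [_ [q Tq <-] /ltW qd] := inf_adherent n0 Sinf; exists q.
have [|q xq] := @wsq_complete _ _ _ _ s0 x.
  move=> e e0; have [|N Ne] := natSinv_lt (e := e / 4).
    by rewrite divr_gt0.
  exists N => m n Nn nm.
  have [Tm xm] := xP m; have [Tn xn] := xP n.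
  apply: le_lt_trans (near_minimizer_dist dmin Tm Tn xm xn) _.
  move: (m.+1%:R^-1) (n.+1%:R^-1) (Ne _ Nn) (Ne _ (leq_trans Nn nm)).
  move=> a b ha hb; lra.
have Tq : T q.
  apply: (closed_wsq s0 clT) => e /xq[N Ne]; exists (x N); last exact: Ne.
  by have [] := xP N.
exists q; split=> // r Tr; apply/eqP; rewrite -sqrf_eq0 eq_le sqr_ge0 andbT.
apply/ler_addgt0Pl => e e0; rewrite addr0.
have r0 : 0 < 4 * (wsq s r + 1).
  by rewrite mulr_gt0// ltr_wpDl// wsq_ge0.
(* The factor 4 absorbs [(a + b) ^+ 2 <= 2 a ^+ 2 + 2 b ^+ 2]; adding 1 to
   [wsq s r] avoids a division by zero. *)
pose e' := e / (4 * (wsq s r + 1)); have e'0 : 0 < e' by rewrite divr_gt0.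
have [N1 N1e] := natSinv_lt e'0; have [N2 N2e] := xq _ e'0.
pose n := maxn N1 N2; have [Tn xn] := xP n.
have h1 := near_minimizer_orth s0 dmin Tn xn Tr.
have h2 := wdot_cauchy_schwarz s0 (x n - q) r.
have -> : p - q = (p - x n) + (x n - q) by rewrite addrA subrK.
have {}h1 : wdot s (p - x n) r ^+ 2 <= e' * wsq s r.
  apply: le_trans h1 _; rewrite ler_wpM2r ?wsq_ge0// ltW// N1e//.
  exact: leq_maxl.
have {}h2 : wdot s (x n - q) r ^+ 2 <= e' * wsq s r.
  apply: le_trans h2 _; rewrite ler_wpM2r ?wsq_ge0// ltW// N2e//.
  exact: leq_maxr.
have h3 : 4 * (e' * wsq s r) <= e.
  rewrite /e'; have -> : 4 * (e / (4 * (wsq s r + 1)) * wsq s r) =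
    e * (wsq s r / (wsq s r + 1)).
    by field; rewrite gt_eqF// ltr_wpDl// wsq_ge0.
  rewrite ger_pMr// ler_pdivrMr ?ltr_wpDl ?wsq_ge0// mul1r; lra.
rewrite wdotDl; move: (wdot _ _ _) (wdot _ _ _) h1 h2 => a b h1 h2.
have := sqr_ge0 (a - b); nra.
Qed.

End Projection.

(** * Regularization of a closed operator *)

Section Regularization.
Variables (R : realType) (H K : hilbertType R) (C : set (H * K)).
Hypothesis linC : linear_relation C.

Lemma orth_proj_min s p q r : 0 < s -> orth_proj C s p q -> C r ->
  wsq s (p - q) <= wsq s (p - r).
Proof.
by move=> s0 pq Cr; rewrite (orth_proj_pythagoras linC pq Cr) lerDl wsq_ge0.
Qed.

(** Pythagoras at the point [0] of [C]: the value at [0] is [s |h|^2]. *)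
Lemma regularization_bounded s h q : 0 < s -> orth_proj C s (h, 0) q ->
  hnorm q.2 <= Num.sqrt s * hnorm h.
Proof.
move=> s0 pq; have := orth_proj_pythagoras linC pq linC.1.
rewrite !subr0 [LHS]wsqE /= hnorm0 expr0n /= add0r => e.
rewrite -(ler_pXn2r (n := 2)) ?nnegrE ?mulr_ge0 ?sqrtr_ge0 ?hnorm_ge0//.
rewrite exprMn sqr_sqrtr ?(ltW s0)// e.
by apply: le_trans (hnorm_snd_sq_le s0 q) _; rewrite lerDr wsq_ge0.
Qed.

(** Write [a], [a'] for the squares of [|q.2|], [|q'.2|] and [b], [b'] for those
    of [|h - q.1|], [|h - q'.1|]. Adding the two minimality inequalities
    [a + s b <= a' + s b'] and [a' + s' b' <= a + s' b] gives [b' <= b], and then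
    the first one gives [a <= a']. *)
Lemma regularization_monotone s s' h q q' : 0 < s -> s < s' ->
  orth_proj C s (h, 0) q -> orth_proj C s' (h, 0) q' ->
  hnorm q.2 <= hnorm q'.2.
Proof.
move=> s0 ss' pq pq'; have s'0 := lt_trans s0 ss'.
have := orth_proj_min s0 pq pq'.1; have := orth_proj_min s'0 pq' pq.1.
rewrite !wsqE /= !sub0r !hnormN => h1 h2.
rewrite -(ler_pXn2r (n := 2)) ?nnegrE ?hnorm_ge0//.
move: (hnorm q.2 ^+ 2) (hnorm q'.2 ^+ 2) h1 h2 => a a'.
move: (hnorm (h - q.1) ^+ 2) (hnorm (h - q'.1) ^+ 2) => b b' h1 h2.
have : (s' - s) * (b' - b) <= 0 by lra.
rewrite pmulr_rle0 ?subr_gt0// subr_le0 => bb.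
have : s * b' <= s * b by rewrite ler_pM2l.
lra.
Qed.

Hypothesis clC : closed C.
Hypothesis funC : forall h k k', C (h, k) -> C (h, k') -> k = k'.

(** Let [t n] be the minimal value for the weight [n + 1]. Since the form grows
    with the weight, Pythagoras gives [|x m - x n|^2 <= t m - t n] for [n <= m],
    and [t] is bounded by [|k|^2], its competitor being [(h, k)]. So [x]
    converges in [C]; as [(n + 1) |h - (x n).1|^2 <= t n], the limit is above
    [h], hence it is [(h, k)]. *)
Lemma regularization_cvg h k (x : nat -> H * K) : C (h, k) ->
  (forall n, orth_proj C n.+1%:R (h, 0) (x n)) ->
  hnorm (x n).2 @[n --> \oo] --> hnorm k.
Proof.
move=> Chk xP; set p : H * K := (h, 0) in xP.
have n0 n : 0 < n.+1%:R :> R by [].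
pose t n := wsq n.+1%:R (p - x n).
have tk n : t n <= hnorm k ^+ 2.
  apply: le_trans (orth_proj_min (n0 n) (xP n) Chk) _.
  by rewrite wsqE /= subrr hnorm0 sub0r hnormN expr0n /= mulr0 addr0.
have tmono m n : (n <= m)%N -> wsq n.+1%:R (p - x m) <= t m.
  by move=> nm; apply: wsq_ler; rewrite ler_nat.
have dist m n : (n <= m)%N -> wsq 1 (x m - x n) <= t m - t n.
  move=> nm; rewrite wsqBC.
  apply: (@le_trans _ _ (wsq n.+1%:R (x n - x m))).
    by apply: wsq_ler; rewrite ler1n.
  have := orth_proj_pythagoras linC (xP n) (xP m).1; rewrite -/(t n).
  have := tmono _ _ nm; lra.
have tnd m n : (n <= m)%N -> t n <= t m.
  move=> nm; apply: le_trans (tmono _ _ nm).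
  exact: orth_proj_min (n0 n) (xP n) (xP m).1.
have [|q xq] := @wsq_complete _ _ _ _ (@ltr01 R) x.
  move=> e /(bounded_nondecreasing_cauchy tnd tk)[N tN].
  by exists N => m n Nn nm; apply: le_lt_trans (dist _ _ nm) _; exact: tN.
have Cq : C q.
  apply: (closed_wsq ltr01 clC) => e /xq[N Ne].
  by exists (x N); [exact: (xP N).1|exact: Ne].
have xq' (e : R) : 0 < e -> exists N, forall n, (N <= n)%N ->
    hnorm (x n - q).1 < e /\ hnorm (x n - q).2 < e.
  move=> e0; have [|N Ne] := xq (Num.min (e ^+ 2) (1 * e ^+ 2)).
    by rewrite lt_min mul1r exprn_gt0.
  by exists N => n /Ne; exact: hnorm_lt_of_wsq.
have qh : q.1 = h.
  apply/eqP; rewrite -subr_eq0; apply/eqP/hnorm_eq0/eqP.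
  rewrite eq_le hnorm_ge0 andbT; apply/ler_addgt0Pl => e e0; rewrite addr0.
  have e20 : 0 < e / 2 by rewrite divr_gt0.
  have M0 : 0 < hnorm k ^+ 2 + 1 by rewrite ltr_wpDl// sqr_ge0.
  have [N1 N1e] := xq' _ e20.
  have [|N2 N2e] := natSinv_lt (e := (e / 2) ^+ 2 / (hnorm k ^+ 2 + 1)).
    by rewrite divr_gt0// exprn_gt0.
  pose n := maxn N1 N2.
  have [h1 _] := N1e n (leq_maxl _ _).
  have {N2e} := N2e n (leq_maxr _ _); rewrite ltr_pdivlMr// => h2.
  have h3 : hnorm (p - x n).1 < e / 2.
    rewrite -(ltr_pXn2r (n := 2))// ?nnegrE ?hnorm_ge0 ?(ltW e20)//.
    apply: le_lt_trans (hnorm_fst_sq_le (n0 n) _) _; apply: le_lt_trans h2.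
    rewrite mulrC ler_wpM2l ?invr_ge0//.
    by apply: le_trans (tk n) _; rewrite lerDl.
  have -> : q.1 - h = - (x n - q).1 + - (p - x n).1.
    by rewrite /= !opprB addrA subrK.
  apply: le_trans (ler_hnormD _ _) _; rewrite !hnormN; lra.
have qk : q.2 = k by apply: (funC _ Chk); rewrite -qh -surjective_pairing.
apply/cvgrPdist_lt => e /xq'[N xN]; exists N => // n /= Nn.
rewrite distrC; apply: le_lt_trans (ler_hnorm_dist _ _) _.
by rewrite -qk; have [] := xN n Nn.
Qed.

End Regularization.

(** * Factorizations, closability and almost domination *)

Section Relations.
Variables (R : realType) (E H K : hilbertType R).

Lemma closure_linear_relation (T : set (H * K)) :
  linear_relation T -> linear_relation (closure T).
Proof.
move=> linT; split; first exact/subset_closure/linT.1.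
move=> a [h k] [h' k'] /closure_hnorm Tu /closure_hnorm Tv.
apply/closure_hnorm => e e0.
have a0 : 0 <= complex.Re `|a| by have := normr_ge0 a; rewrite lecE => /andP[].
have a1 : 0 < complex.Re `|a| + 1 by rewrite ltr_wpDl.
have d0 : 0 < e / (complex.Re `|a| + 1) by rewrite divr_gt0.
have [u [v [Tuv hu kv]]] := Tu _ d0; have [u' [v' [Tuv' hu' kv']]] := Tv _ d0.
exists (a *: u + u'), (a *: v + v').
have est (X : hilbertType R) (x x' y y' : X) :
    hnorm (x - y) < e / (complex.Re `|a| + 1) ->
    hnorm (x' - y') < e / (complex.Re `|a| + 1) ->
    hnorm (a *: x + x' - (a *: y + y')) < e.
  rewrite opprD addrACA -scalerBr => xy xy'.
  apply: le_lt_trans (ler_hnormD _ _) _; rewrite hnormZ.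
  rewrite [ltRHS](_ : e = complex.Re `|a| * (e / (complex.Re `|a| + 1)) +
    e / (complex.Re `|a| + 1)); last by field; rewrite gt_eqF.
  by rewrite ler_ltD// ler_wpM2l// ltW.
by split; [exact: linT.2 Tuv Tuv'|exact: est|exact: est].
Qed.

Lemma factors_graph (A : E -> H) (B : E -> K) C f :
  factors B C A -> C (A f, B f).
Proof.
move=> [_ BCA]; have : graph B (f, B f) by [].
by rewrite BCA => -[h []]; rewrite /graph /= => ->.
Qed.

Lemma graph_factors (A : E -> H) (B : E -> K) C : linear_operator C ->
  (forall f, C (A f, B f)) -> factors B C A.
Proof.
move=> [_ funC] CAB; split; first by move=> _ [f _ <-]; exists (B f).
rewrite /graph; apply/seteqP; split=> -[f k] /=.
  by move=> ->; exists (A f).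
by move=> [_ [/= -> Cfk]]; exact: funC Cfk (CAB f).
Qed.

Lemma rel_L_sub (A : E -> H) (B : E -> K) C :
  factors B C A -> rel_L A B `<=` C.
Proof. by move=> BCA _ [f _ <-]; exact: (factors_graph f BCA). Qed.

Lemma rel_L_linear (A : {linear E -> H}) (B : {linear E -> K}) :
  linear_relation (rel_L A B).
Proof.
split; first by exists 0 => //; rewrite !linear0.
move=> a _ _ [f _ <-] [g _ <-]; exists (a *: f + g) => //.
by rewrite !linearP.
Qed.

(** Closability only has to be tested above [0], the closure being linear. Two
    approximations of [(0, k)] are needed: [f] is fixed first, and then, for each
    [n], some [g] whose [A g] is small compared with the constant [c n]. *)
Lemma almost_dominated_closure0 (A : {linear E -> H}) (B : {linear E -> K}) k :
  almost_dominated B A -> closure (rel_L A B) (0, k) -> k = 0.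
Proof.
move=> [Kn [Bn [c [_ c0 BnP]]]] /closure_hnorm clk.
(* An increasing sequence stays below its limit. *)
have BnB n f : hnorm (Bn n f) <= hnorm (B f).
  have [_ mono cv] := BnP f; rewrite -(cvg_lim _ cv)//.
  apply: (nondecreasing_cvgn_le (u_ := fun n => hnorm (Bn n f))).
    exact/nondecreasing_seqP.
  by apply/cvg_ex; exists (hnorm (B f)).
apply/hnorm_eq0/eqP; rewrite eq_le hnorm_ge0 andbT.
apply/ler_addgt0Pl => e e0; rewrite addr0.
have e40 : 0 < e / 4 by rewrite divr_gt0.
have [_ [_ [[f _ [<- <-]] _ kf]]] := clk _ e40.
have Bf : hnorm (B f) <= 3 * (e / 4).
  have [_ _ cv] := BnP f; rewrite -(cvg_lim _ cv)//.
  apply: limr_le; first by apply/cvg_ex; exists (hnorm (B f)).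
  apply: nearW => n; have c1 : 0 < c n + 1 by rewrite ltr_wpDl.
  have d0 : 0 < Num.min (e / 4) (e / 4 / (c n + 1)).
    by rewrite lt_min e40 divr_gt0.
  have [_ [_ [[g _ [<- <-]]]]] := clk _ d0.
  rewrite sub0r hnormN !lt_min => /andP[_ Ag] /andP[kg _].
  have -> : f = (f - g) + g by rewrite subrK.
  rewrite linearD; apply: le_trans (ler_hnormD _ _) _.
  have [/(_ n) Bg _ _] := BnP g.
  have {Ag} Ag : c n * hnorm (A g) <= e / 4.
    move: Ag; rewrite ltr_pdivlMr// => Ag; apply: le_trans (ltW Ag).
    by rewrite mulrDr mulr1 mulrC lerDl hnorm_ge0.
  have := BnB n (f - g); rewrite (linearB B) /=.
  have -> : B f - B g = (k - B g) - (k - B f).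
    by rewrite opprB [RHS]addrC addrA subrK.
  have := ler_hnormD (k - B g) (- (k - B f)); rewrite hnormN.
  lra.
have -> : k = (k - B f) + B f by rewrite subrK.
apply: le_trans (ler_hnormD _ _) _; lra.
Qed.

Lemma almost_dominated_closable (A : {linear E -> H}) (B : {linear E -> K}) :
  almost_dominated B A -> closable_operator (rel_L A B).
Proof.
move=> BA; have linL := rel_L_linear A B.
have lincl := closure_linear_relation linL.
have funcl h k k' : closure (rel_L A B) (h, k) ->
    closure (rel_L A B) (h, k') -> k = k'.
  move=> hk hk'; apply/eqP; rewrite -subr_eq0; apply/eqP.
  apply: (almost_dominated_closure0 BA).
  have := lincl.2 (- 1) _ _ hk' hk.
  have -> : -1 *: (h, k') + (h, k) = (0, k - k') :> H * K.
    by rewrite scaleN1r; congr pair; rewrite /= addrC ?subrr.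
  by [].
split; split=> // h k k' hk hk'.
by apply: funcl (subset_closure hk) (subset_closure hk').
Qed.

(** The weights [n.+1] start at 1 because the projection needs a positive one.
    Linearity of the minimizer follows from its uniqueness. *)
Lemma closed_factor_almost_dominated (A : {linear E -> H})
    (B : {linear E -> K}) C : bounded_operator A ->
  closed_operator C -> factors B C A -> almost_dominated B A.
Proof.
move=> [M AM] [[linC funC] clC] BCA.
have n0 n : 0 < n.+1%:R :> R by [].
have /choice[x xP] : forall n, exists xn : E -> H * K,
    forall f, orth_proj C n.+1%:R (A f, 0) (xn f).
  move=> n.
  have [xn xnP] := choice (fun f => orth_proj_exists linC (A f, 0) (n0 n) clC).
  by exists xn.
have linx n : linear (fun f => (x n f).2).
  move=> a f g; suff -> : x n (a *: f + g) = a *: x n f + x n g by [].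
  apply: (orth_proj_inj linC (n0 n) (xP n _)).
  have := orth_projL linC a (xP n f) (xP n g).
  suff -> : a *: (A f, 0) + (A g, 0) = (A (a *: f + g), 0) :> H * K by [].
  by rewrite linearP; congr pair; rewrite /= scaler0 addr0.
pose Bn n : {linear E -> K} := HB.pack (fun f => (x n f).2)
  (GRing.isLinear.Build _ _ _ _ _ (linx n)).
have bound n f : hnorm (Bn n f) <= Num.sqrt n.+1%:R * hnorm (A f).
  exact: regularization_bounded (xP n f).
exists (fun=> K), Bn, (fun n => Num.sqrt n.+1%:R); split.
- move=> n; exists (Num.sqrt n.+1%:R * M) => f.
  by apply: le_trans (bound n f) _; rewrite -mulrA ler_wpM2l ?sqrtr_ge0.
- by move=> n; exact: sqrtr_ge0.
- move=> f; split=> // [n|].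
    apply: (regularization_monotone linC (n0 n) _ (xP n f) (xP n.+1 f)).
    by rewrite ltr_nat.
  exact: (regularization_cvg linC clC funC (factors_graph f BCA) (xP^~ f)).
Qed.

End Relations.

Theorem theorem7p4 (R : realType) (E H K : hilbertType R)
    (A : {linear E -> H}) (B : {linear E -> K})
    (bA : bounded_operator A) (bB : bounded_operator B) :
  let cond_i := almost_dominated B A in
  let cond_ii := exists C : set (H * K), closable_operator C /\ factors B C A in
  let cond_iii := exists C : set (H * K), closed_operator C /\ factors B C A in
  [/\ (cond_i <-> cond_ii) /\ (cond_ii <-> cond_iii),
      cond_i \/ cond_ii \/ cond_iii ->
        closable_operator (rel_L A B) /\ factors B (rel_L A B) A,
      forall C : set (H * K),
        closable_operator C -> factors B C A -> rel_L A B `<=` C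
    & forall C : set (H * K),
        closed_operator C -> factors B C A -> closure (rel_L A B) `<=` C].
Proof.
move=> cond_i cond_ii cond_iii.
have L_ok : cond_i -> closable_operator (rel_L A B) /\ factors B (rel_L A B) A.
  move=> /almost_dominated_closable Lcl; split=> //.
  by apply: graph_factors => [|f]; [exact: Lcl.1|exists f].
have i_ii : cond_i -> cond_ii by move=> /L_ok; exists (rel_L A B).
have ii_iii : cond_ii -> cond_iii.
  move=> [C [[_ clC] BCA]]; exists (closure C); split.
    by split=> //; exact: closed_closure.
  apply: graph_factors => // f; apply: subset_closure.
  exact: (factors_graph f BCA).
have iii_i : cond_iii -> cond_i.
  by move=> [C [clC BCA]]; exact: closed_factor_almost_dominated BCA.
split.
- by split; split=> //; [move=> /ii_iii/iii_i|move=> /iii_i/i_ii].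
- by move=> [|[/ii_iii/iii_i|/iii_i]]; exact: L_ok.
- by move=> C _; exact: rel_L_sub.
- move=> C [_ clC] BCA; rewrite (closure_id C).1//.
  by apply: closure_subset; exact: rel_L_sub.
Qed.
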